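(* Let $n$ be a positive integer. For any linear subspace $V\subseteq\mathbb{R}^n$, either $V$ contains a nonzero, nonnegative vector or $V^\perp$ contains a nonzero, nonnegative vector (the ''or'' is inclusive).
   Context: A vector $x\in\mathbb{R}^n$ is called nonnegative if all of its components (in the standard basis) satisfy $x_i\geq 0$. $V^\perp$ denotes the orthogonal complement of $V$ with respect to the standard inner product on $\mathbb{R}^n$. *)

(* Defs.v *)
From HB Require Import structures.
From mathcomp Require Import all_boot all_order all_algebra.
From mathcomp Require Import sesquilinear reals.

Set Implicit Arguments.
Unset Strict Implicit.
Unset Printing Implicit Defensive.

Import Order.TTheory GRing.Theory Num.Theory.
Local Open Scope ring_scope.

Definition std_dot (R : realType) (n : nat) (u v : 'rV[R]_n) : R :=
  \sum_(i < n) u 0 i * v 0 i.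

Lemma std_dot_is_bilinear (R : realType) (n : nat) :
  bilinear_for *%R (idfun \; *%R) (@std_dot R n).
Proof.
split=> [w a u v|w a u v] /=; rewrite /std_dot mulr_sumr -big_split /=;
  apply: eq_bigr => i _; rewrite !mxE ?mulrDl ?mulrDr ?mulrA //.
by rewrite [w 0 i * a]mulrC.
Qed.

(* The library types the second scaling of a theta-hermitian form as
   [theta \; *%R]; here theta is [idfun]. *)
HB.instance Definition _ (R : realType) (n : nat) :=
  bilinear_isBilinear.Build R 'rV[R]_n 'rV[R]_n R *%R (idfun \; *%R) (@std_dot R n)
    (@std_dot_is_bilinear R n).

Lemma std_dot_is_symmetric (R : realType) (n : nat) (u v : 'rV[R]_n) :
  std_dot u v = (-1) ^+ false * idfun (std_dot v u).
Proof. by rewrite expr0 mul1r; apply: eq_bigr => i _; rewrite mulrC. Qed.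

HB.instance Definition _ (R : realType) (n : nat) :=
  isHermitianSesquilinear.Build R 'rV[R]_n false idfun (@std_dot R n)
    (@std_dot_is_symmetric R n).

Definition nonneg_vec (R : realType) (n : nat) (x : 'rV[R]_n) : Prop :=
  forall i : 'I_n, 0 <= x 0 i.

Definition orth_compl (R : realType) (n : nat) (V : {vspace 'rV[R]_n}) :
    {vspace 'rV[R]_n} :=
  orthov (@std_dot R n) V.

Lemma orth_complP (R : realType) (n : nat) (V : {vspace 'rV[R]_n})
    (u : 'rV[R]_n) :
  reflect (forall v, v \in V -> std_dot u v = 0) (u \in orth_compl V).
Proof. exact: mem_orthovP. Qed.

(* Main.v *)
Require Import Defs.
From mathcomp Require Import all_boot all_order all_algebra.
From mathcomp Require Import reals.

Import Order.TTheory GRing.Theory Num.Theory.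
Local Open Scope ring_scope.

(** The proof is by induction on the dimension of the ambient space.  Delete
    the first coordinate of the vectors of [V]: the orthogonal complement of
    the resulting projection consists of the [w] such that [(0, w)] lies in the
    complement of [V].  The induction hypothesis, applied to the projection of
    [V], therefore yields either a vector [(b, v)] of [V] with [v] nonzero and
    nonnegative, or [(0, w)] in the complement with [w] nonzero and nonnegative,
    which is a solution.  Exchanging [V] and its complement yields either a
    vector [(a, w)] of the complement with [w] nonzero and nonnegative, or a
    solution in [V].  In the remaining case, orthogonality says
    [b * a + v . w = 0] with [v . w >= 0], so [a] and [b] cannot both be
    negative, and [(b, v)] or [(a, w)] is a solution.

    The induction, [row_space_nonneg_alternative], is carried out on row spaces
    of matrices, where the projection is a block of the matrix and the equality
    of [V] with its double complement is built into the definition of the order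
    on row spaces: [u <= A] means [u *m cokermx A = 0], and the columns of
    [cokermx A] span the complement of the rows of [A]. *)

(** The two alternatives are left unsolved only if both first coordinates are
    negative, and then the inner product would be positive. *)
Lemma orthogonal_head_ge0 (R : realFieldType) (n : nat)
    (v w : 'rV[R]_(1 + n)) :
    v *m w^T = 0 ->
    (forall i, 0 <= rsubmx v 0 i) -> (forall i, 0 <= rsubmx w 0 i) ->
  0 <= lsubmx v 0 0 \/ 0 <= lsubmx w 0 0.
Proof.
move=> /matrixP /(_ 0 0) vw0 v_ge0 w_ge0.
have [|v_lt0] := leP 0 (lsubmx v 0 0); first by left.
have [|w_lt0] := leP 0 (lsubmx w 0 0); first by right.
move: vw0; rewrite -[v]hsubmxK -[w]hsubmxK tr_row_mx mul_row_col.
rewrite !mxE big_ord1 !mxE => /eqP; rewrite gt_eqF //.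
rewrite ltr_wpDr //.
  by apply: sumr_ge0 => i _; have := mulr_ge0 (v_ge0 i) (w_ge0 i); rewrite !mxE.
by move: v_lt0 w_lt0; rewrite !mxE => v_lt0 w_lt0; rewrite nmulr_rgt0.
Qed.

Lemma row_nonneg_split (R : realFieldType) (n : nat) (x : 'rV[R]_(1 + n)) :
    0 <= lsubmx x 0 0 -> (forall i, 0 <= rsubmx x 0 i) ->
  forall i, 0 <= x 0 i.
Proof.
move=> l_ge0 r_ge0 i; rewrite -[x]hsubmxK mxE.
by case: splitP => j _; rewrite // (ord1 j).
Qed.

Lemma rsubmx_neq0 (R : realFieldType) (n : nat) (x : 'rV[R]_(1 + n)) :
  rsubmx x != 0 -> x != 0.
Proof. by apply: contraNneq => ->; rewrite linear0. Qed.

(** The induction step uses the hypothesis twice: on [rsubmx A], and on the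
    same block of a matrix whose rows span the complement of the row space of
    [A].  A solution of either second alternative is extended by a zero, so only
    the two first alternatives have to be played against each other.  The number
    of rows is left free because this second matrix is square whatever [m]. *)
Lemma row_space_nonneg_alternative (R : realFieldType) (n m : nat)
    (A : 'M[R]_(m, n.+1)) :
  (exists x : 'rV[R]_n.+1,
     [/\ (x <= A)%MS, x != 0 & forall i, 0 <= x 0 i]) \/
  (exists x : 'rV[R]_n.+1,
     [/\ A *m x^T = 0, x != 0 & forall i, 0 <= x 0 i]).
Proof.
elim: n m A => [|n IHn] m A.
  have one_neq0 : const_mx 1 != 0 :> 'rV[R]_1.
    by apply/eqP => /matrixP/(_ 0 0)/eqP; rewrite !mxE oner_eq0.
  have one_ge0 i : 0 <= (const_mx 1 : 'rV[R]_1) 0 i by rewrite mxE.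
  have [->|/matrix0Pn[i [j Aij]]] := eqVneq A 0.
    by right; exists (const_mx 1); rewrite mul0mx.
  left; exists (const_mx 1); split=> //.
  have -> : const_mx 1 = (A i j)^-1 *: row i A.
    by apply/rowP => k; rewrite !mxE (ord1 k) -(ord1 j) mulVf.
  by rewrite scalemx_sub // row_sub.
change (n.+2) with (1 + n.+1)%N in A |- *.
have row_mx0_nonneg (w : 'rV[R]_n.+1) : w != 0 -> (forall i, 0 <= w 0 i) ->
    row_mx (0 : 'M_1) w != 0 /\ (forall i, 0 <= row_mx (0 : 'M_1) w 0 i).
  move=> w_neq0 w_ge0; split; first by rewrite rsubmx_neq0 ?row_mxKr.
  by apply: row_nonneg_split => [|i]; rewrite ?row_mxKl ?row_mxKr // mxE.
have [[_ [/submxP[y ->] v_neq0 v_ge0]]|[w [Aw w_neq0 w_ge0]]] :=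
  IHn m (rsubmx A); last first.
  have [x_neq0 x_ge0] := row_mx0_nonneg w w_neq0 w_ge0.
  right; exists (row_mx 0 w); split=> //.
  by rewrite -[A]hsubmxK tr_row_mx mul_row_col Aw trmx0 mulmx0 addr0.
(* The rows of B span the orthogonal complement of the row space of A. *)
pose B := (cokermx A)^T.
have [[_ [/submxP[z ->] w_neq0 w_ge0]]|[v [Bv Bv_neq0 Bv_ge0]]] :=
  IHn _ (rsubmx B); last first.
  have [x_neq0 x_ge0] := row_mx0_nonneg v Bv_neq0 Bv_ge0.
  left; exists (row_mx 0 v); split=> //.
  rewrite submxE -[cokermx A]trmxK -/B -trmx_eq0 trmx_mul trmxK.
  by rewrite -[B]hsubmxK tr_row_mx mul_row_col Bv trmx0 mulmx0 addr0.
have AzB : A *m (z *m B)^T = 0.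
  by rewrite trmx_mul trmxK mulmxA mulmx_coker mul0mx.
have rsubM p q (u : 'M[R]_(p, q)) (C : 'M_(q, 1 + n.+1)) :
  u *m rsubmx C = rsubmx (u *m C) by rewrite -[C in RHS]hsubmxK mul_mx_row row_mxKr.
rewrite !rsubM in v_neq0 v_ge0 w_neq0 w_ge0.
have := @orthogonal_head_ge0 _ _ (y *m A) (z *m B).
rewrite -mulmxA AzB mulmx0 => /(_ erefl v_ge0 w_ge0)[] h_ge0.
  left; exists (y *m A); split; [exact: submxMl|exact: rsubmx_neq0|].
  exact: row_nonneg_split.
right; exists (z *m B); split=> //; first exact: rsubmx_neq0.
exact: row_nonneg_split.
Qed.

Theorem mainTheorem2 (R : realType) (n : nat) (n_gt0 : (0 < n)%N)
    (V : {vspace 'rV[R]_n}) :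
  (exists x : 'rV[R]_n, [/\ x \in V, x != 0 & nonneg_vec x]) \/
  (exists x : 'rV[R]_n, [/\ x \in orth_compl V, x != 0 & nonneg_vec x]).
Proof.
case: n n_gt0 V => // n _ V.
pose A := \matrix_(i < \dim V) (vbasis V)`_i.
have [[_ [/submxP[y ->] x_neq0 x_ge0]]|[x [Ax x_neq0 x_ge0]]] :=
  row_space_nonneg_alternative R n _ A.
  left; exists (y *m A); split=> //.
  rewrite mulmx_sum_row memv_suml // => i _.
  by rewrite rowK memvZ // vbasis_mem // mem_nth // size_tuple.
right; exists x; split=> //; apply/orth_complP => v /coord_vbasis->.
rewrite linear_sumr big1 // => i _; rewrite linearZr_LR /=.
have /matrixP/(_ i 0) := Ax; rewrite !mxE => Axi.
rewrite [std_dot _ _](_ : _ = 0) ?mulr0 // -[RHS]Axi.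
by apply: eq_bigr => j _; rewrite !mxE mulrC.
Qed.
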